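(* Let $\lambda\in\mathbb{R}_+$, let $r\in(0,1)$ be fixed, and let $c_\ell$ be the speed function on $\mathbb{R}^2_+$ $$c_\ell(x,y)=\begin{cases}1,& \text{if } y>x-\lambda,\\ r,& \text{if } y\le x-\lambda.\end{cases}$$ There exist explicitly computable functions $A(r), D(r)$, namely $$A(r)=\frac{(1+\sqrt{1-r})^2}{r},\qquad D(r)=4\lambda\frac{\sqrt{1-r}}{r},$$ and some optimal point $a^*>\lambda$ so that for any $(x,y)\in\mathbb{R}^2_+$ the limiting shape function is given by $$\Gamma_{c_\ell}(x,y)=\begin{cases}\gamma(x,y),&\text{if } y\ge L(x,y),\\ I(x,y),&\text{if } x-\lambda\le y\le L(x,y),\\ \gamma(a^*,a^*-\lambda)+r^{-1}\gamma(x-a^*,y-a^*+\lambda),&\text{if } y<x-\lambda,\end{cases}$$ where $I(x,y)$ is a linear section of $\Gamma_{c_\ell}(x,y)$, given by $$I(x,y)=(1+A(r))x+\Big(1+\frac{1}{A(r)}\Big)y-D(r),$$ and $L(x,y)$ is described by the equation $$\Big(A(r)x-\frac{1}{A(r)}y\Big)^2-2D(r)\Big(A(r)x+\frac{1}{A(r)}y\Big)+D(r)^2=0.$$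
   Context: $\mathbb{R}_+=[0,\infty)$ and $\gamma(x,y)=(\sqrt x+\sqrt y)^2$. $\mathcal H(x,y)$ is the set of continuous, piecewise $C^1$ paths $\mathbf x=(x_1,x_2):[0,1]\to\mathbb{R}^2_+$ with $\mathbf x(0)=(0,0)$, $\mathbf x(1)=(x,y)$ and $\mathbf x'(s)\in\mathbb{R}^2_+$ wherever the derivative is defined. For a speed function $c$, the limiting shape function is $$\Gamma_c(x,y)=\sup_{\mathbf x\in\mathcal H(x,y)}\int_0^1\frac{\gamma(\mathbf x'(s))}{c(x_1(s),x_2(s))}\,ds.$$ It is the limiting constant for $n^{-1}$ times the directed (up-right) last passage time from $(0,0)$ to $(\lfloor nx\rfloor,\lfloor ny\rfloor)$ when the weights at sites $(i,j)$ are independent exponential random variables of rate $c(i/n,j/n)$.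
   Formalization: The optimal point a* depends on (x,y); a*>λ is asserted only when λ>0 and y>0 (otherwise a*=λ is forced), a*≥λ in general; L is read as the arc of the parabola right of its tangency with y=x−λ, and Γ=γ above the line left of that point. *)

(* Defs.v *)
From HB Require Import structures.
From mathcomp Require Import all_boot all_order all_algebra.
From mathcomp Require Import all_classical all_reals all_analysis.
Set Implicit Arguments.
Unset Strict Implicit.
Unset Printing Implicit Defensive.
Import Order.TTheory GRing.Theory Num.Theory.
Import numFieldNormedType.Exports.
Local Open Scope classical_set_scope.
Local Open Scope ring_scope.

Definition gam {R : realType} (x y : R) : R := (Num.sqrt x + Num.sqrt y) ^+ 2.

(* [f] is C^1 on the closed interval: [g] is the derivative, extended by its
   one-sided limits at the endpoints. *)
Definition C1_on {R : realType} (f : R -> R) (a b : R) : Prop :=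
  exists2 g : R -> R, {within `[a, b], continuous g} &
    forall s, s \in `]a, b[ -> is_derive s 1 f (g s).

Definition piecewise_C1 {R : realType} (f1 f2 : R -> R) (a b : R) : Prop :=
  exists2 t : seq R, itv_partition a b t &
    forall i, (i < size t)%N ->
      C1_on f1 (nth a (a :: t) i) (nth a t i) /\
      C1_on f2 (nth a (a :: t) i) (nth a t i).

(* A path is a pair of functions R -> R, of which only the restriction to
   [0, 1] matters. *)
Definition paths {R : realType} (x y : R) : set ((R -> R) * (R -> R)) :=
  [set p : (R -> R) * (R -> R) |
          [/\ {within `[0 : R, 1], continuous p.1} /\
               {within `[0 : R, 1], continuous p.2},
               piecewise_C1 p.1 p.2 0 1,
               (forall s, s \in `[0, 1] -> 0 <= p.1 s /\ 0 <= p.2 s),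
               [/\ p.1 0 = 0, p.2 0 = 0, p.1 1 = x & p.2 1 = y] &
               forall s, s \in `]0, 1[ ->
                 derivable p.1 s 1 -> derivable p.2 s 1 ->
                 0 <= derive1 p.1 s /\ 0 <= derive1 p.2 s]].

(* Lebesgue integral: along a general path [c (p.1 s) (p.2 s)] need not be
   Riemann integrable when [c] is discontinuous.  At the finitely many
   breakpoints the value of the derivative is irrelevant. *)
Definition path_time {R : realType} (c : R -> R -> R)
    (p : (R -> R) * (R -> R)) : \bar R :=
  (\int[@lebesgue_measure R]_(s in `[0%R, 1%R])
     (gam (derive1 p.1 s) (derive1 p.2 s) / c (p.1 s) (p.2 s))%:E)%E.

Definition Gam {R : realType} (c : R -> R -> R) (x y : R) : \bar R :=
  ereal_sup [set path_time c p | p in paths x y].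

Definition c_ell {R : realType} (lambda r : R) (x y : R) : R :=
  if x - lambda < y then 1 else r.

Definition Acoef {R : realType} (r : R) : R := (1 + Num.sqrt (1 - r)) ^+ 2 / r.

Definition Dcoef {R : realType} (lambda r : R) : R :=
  4 * lambda * (Num.sqrt (1 - r) / r).

Definition Isec {R : realType} (lambda r x y : R) : R :=
  (1 + Acoef r) * x + (1 + (Acoef r)^-1) * y - Dcoef lambda r.

Definition conic {R : realType} (lambda r x y : R) : R :=
  (Acoef r * x - (Acoef r)^-1 * y) ^+ 2
  - 2 * Dcoef lambda r * (Acoef r * x + (Acoef r)^-1 * y)
  + Dcoef lambda r ^+ 2.

(* The conic is a whole parabola, tangent to the line y = x - lambda at a
   single point, of abscissa [x0].  The interface y = L x is its arc issuing
   from that point to the right, inside the region y >= x - lambda; continuity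
   of [L] rules out the other root of the equation in y.  For x < x0 no arc
   separates the region y >= x - lambda, where the shape function is [gam]. *)
Definition interface {R : realType} (lambda r x0 : R) (L : R -> R) : Prop :=
  [/\ lambda <= x0 /\ conic lambda r x0 (x0 - lambda) = 0,
      L x0 = x0 - lambda,
      {within `[x0, +oo[, continuous L} &
      forall x, x0 <= x -> x - lambda <= L x /\ conic lambda r x (L x) = 0].

(* Value of the two-segment path (0,0) -> (a, a - lambda) -> (x, y) that meets
   the line y = x - lambda at abscissa [a]. *)
Definition crossing {R : realType} (lambda r x y a : R) : R :=
  gam a (a - lambda) + r^-1 * gam (x - a) (y - a + lambda).

(* lambda <= a <= y + lambda is exactly nonnegativity of all arguments of
   [gam] in [crossing] when y < x - lambda.  If lambda = 0 or y = 0 the only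
   optimal point is a = lambda, so lambda < a is asserted in the other case. *)
Definition optimal_point {R : realType} (lambda r x y a : R) : Prop :=
  [/\ lambda <= a <= y + lambda,
      0 < lambda -> 0 < y -> lambda < a &
      forall b, lambda <= b <= y + lambda ->
        crossing lambda r x y b <= crossing lambda r x y a].

(* Main.v *)
(* Every u, v >= 0 and t > 0 satisfy gamma(u, v) <= (1 + t) u + (1 + 1/t) v, and
   gamma(u, v) is the infimum of the right-hand sides.  Integrating along a path
   therefore bounds the time of a stretch on which c >= k by gamma(increment)/k,
   whatever the path does there.  Below the line y = x - lambda one splits the
   path at the first time it meets the line; above, at the first and last such
   times, of abscissas a <= b, which gives the bound
     gamma(a, a - lambda) + (4/r)(b - a) + gamma(x - b, y - b + lambda).
   As 4/r = 2 + A + 1/A, the tangents t = 1/A and t = A bound this by I(x, y),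
   and monotonicity along the diagonal bounds it by gamma(x, y) outside the
   region of I.  With X = A sqrt x and Y = sqrt y one has
     I - gamma = ((X - Y)^2 - kappa^2) / A,   kappa^2 = lambda (A^2 - 1),
   so the interface is Y = X - kappa.  Broken lines with three pieces attain all
   these bounds. *)
Require Import Defs.
From HB Require Import structures.
From mathcomp Require Import all_boot all_order all_algebra.
From mathcomp Require Import all_classical all_reals all_analysis.
From mathcomp Require Import measurable_realfun ring lra.
Import Order.TTheory GRing.Theory Num.Theory.
Import numFieldNormedType.Exports.
Local Open Scope classical_set_scope.
Local Open Scope ring_scope.

Set Implicit Arguments.
Unset Strict Implicit.

(** * Piecewise C1 functions *)

(** Replaces inductions on partitions: a relation on intervals that survives concatenation need only
    be checked on C1 pieces. The bounds [a <= x] and [y <= b] keep hypotheses on [[a, b]] usable on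
    each piece. *)
Lemma piecewise_C1_ind {R : realType} (f1 f2 : R -> R) (a b : R)
    (P : R -> R -> Prop) :
  (forall x, P x x) ->
  (forall x y z, x <= y -> y <= z -> P x y -> P y z -> P x z) ->
  (forall x y, x < y -> a <= x -> y <= b -> C1_on f1 x y -> C1_on f2 x y ->
    P x y) ->
  piecewise_C1 f1 f2 a b -> P a b.
Proof.
move=> Pxx Ptrans Ppiece [t].
elim: t a Ppiece => [|c t IH] a Ppiece tab tC1.
  by rewrite (itv_partition_nil tab).
have ac : a < c by case: tab => /= /andP[].
have tcb := itv_partition_cons tab.
have cb := itv_partition_le tcb.
have [/= C1f1 C1f2] := tC1 0 isT.
apply: (Ptrans a c b) => //; [exact: ltW|exact: Ppiece|].
apply: IH => // [x y xy cx|i it].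
  by apply: Ppiece => //; rewrite (le_trans (ltW ac)).
have := tC1 i.+1 it => /=.
(* The tail partition starts at [c], so its [nth] has default [c] instead of [a]; the indices are in
   range. *)
by rewrite !(set_nth_default c a) //= ltnW.
Qed.

Lemma derive1_C1 {R : realType} (f g : R -> R) (a b : R) :
  (forall s, s \in `]a, b[ -> is_derive s 1 f (g s)) ->
  {in `]a, b[, derive1 f =1 g}.
Proof. by move=> fg s /fg ?; rewrite derive1E derive_val. Qed.

Lemma measurable_fun_itv_glue {R : realType} (f : R -> R) (x y z : R) :
  x <= y -> y <= z -> measurable_fun `[x, y] f -> measurable_fun `[y, z] f ->
  measurable_fun `[x, z] f.
Proof.
move=> xy yz mxy myz.
rewrite (@itv_bndbnd_setU _ _ _ (BRight y)) ?bnd_simp //.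
by apply/measurable_funU => //; split => //; apply: measurable_fun_itv_oc myz.
Qed.

(** Inside the interval [derive1 f] is the continuous [g]; its uncontrolled values at the two
    endpoints do not affect measurability. *)
Lemma measurable_derive1_C1 {R : realType} (f : R -> R) (a b : R) :
  a < b -> C1_on f a b -> measurable_fun `[a, b] (derive1 f).
Proof.
move=> ab [g cg fg]; apply: (@measurable_fun_itv_cc _ a b false true).
apply: (@eq_measurable_fun _ _ _ _ _ g).
  by move=> s; rewrite inE /= => /(derive1_C1 fg).
apply: subspace_continuous_measurable_fun => //.
by apply: (continuous_subspaceW _ cg); exact: subset_itv_oo_cc.
Qed.

Lemma measurable_derive1_piecewise {R : realType} (f1 f2 : R -> R) (a b : R) :
  piecewise_C1 f1 f2 a b ->
  measurable_fun `[a, b] (derive1 f1) /\ measurable_fun `[a, b] (derive1 f2).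
Proof.
apply: (@piecewise_C1_ind _ _ _ _ _
  (fun x y => measurable_fun `[x, y] (derive1 f1) /\
              measurable_fun `[x, y] (derive1 f2)))
  => [x|x y z xy yz [? ?] [? ?]|x y xy _ _ ? ?].
- by rewrite set_itv1; split; exact: measurable_fun_set1.
- by split; apply: (measurable_fun_itv_glue xy yz).
- by split; exact: measurable_derive1_C1.
Qed.

Lemma ge0_integral_itv_glue {R : realType} (f : R -> R) (x y z : R) :
  x <= y -> y <= z -> measurable_fun `[x, z] f ->
  (\int[lebesgue_measure]_(s in `[x, z]) (f s)%:E =
   \int[lebesgue_measure]_(s in `[x, y]) (f s)%:E +
   \int[lebesgue_measure]_(s in `[y, z]) (f s)%:E)%E.
Proof.
move=> xy yz /measurable_EFinP mf.
have E : [set` `[x, z]] = [set` `[x, y]] `|` [set` `]y, z]].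
  by rewrite -itv_bndbnd_setU // bnd_simp.
rewrite E integral_setU -?E //.
  congr (_ + _)%E; apply: integral_itv_obnd_cbnd.
  by apply: measurable_funS mf => //; rewrite E; exact: subsetUr.
apply/disj_setPS => s [] /=; rewrite !in_itv /= => /andP[_ sy] /andP[ys _].
by have := le_lt_trans sy ys; rewrite ltxx.
Qed.

(** On a C1 piece the linear bound is continuous and integrates by the fundamental theorem of
    calculus; the pieces are then added up. *)
Lemma integral_le_increment {R : realType} (p : (R -> R) * (R -> R))
    (F : R -> R) (al be a b : R) :
  {within `[a, b], continuous p.1} -> {within `[a, b], continuous p.2} ->
  piecewise_C1 p.1 p.2 a b ->
  (forall s, s \in `]a, b[ -> derivable p.1 s 1 -> derivable p.2 s 1 ->
     0 <= derive1 p.1 s /\ 0 <= derive1 p.2 s) ->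
  measurable_fun `[a, b] F -> (forall s, 0 <= F s) ->
  forall u v, a <= u -> u <= v -> v <= b ->
  (forall s, s \in `]u, v[ -> 0 <= derive1 p.1 s -> 0 <= derive1 p.2 s ->
     F s <= al * derive1 p.1 s + be * derive1 p.2 s) ->
  (\int[lebesgue_measure]_(s in `[u, v]) (F s)%:E <=
     (al * (p.1 v - p.1 u) + be * (p.2 v - p.2 u))%:E)%E.
Proof.
move=> c1 c2 pC1 p'_ge0 mF F_ge0.
have int_xx x : (\int[lebesgue_measure]_(s in `[x, x]) (F s)%:E = 0)%E.
  by rewrite set_itv1 integral_set1.
(* [P] ranges over all subintervals of [[x, y]], since [u] and [v] need not be breakpoints. *)
pose P x y := a <= x -> y <= b -> forall u v, x <= u -> u <= v -> v <= y ->
    (forall s, s \in `]u, v[ -> 0 <= derive1 p.1 s -> 0 <= derive1 p.2 s ->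
       F s <= al * derive1 p.1 s + be * derive1 p.2 s) ->
    (\int[lebesgue_measure]_(s in `[u, v]) (F s)%:E <=
     (al * (p.1 v - p.1 u) + be * (p.2 v - p.2 u))%:E)%E.
suff Pab : P a b by move=> u v; exact: Pab.
apply: (@piecewise_C1_ind _ _ _ _ _ P _ _ _ pC1).
- move=> x ax xb u v xu uv vx _.
  have -> : u = x by apply/le_anti; rewrite xu (le_trans uv).
  have -> : v = x by apply/le_anti; rewrite vx (le_trans xu).
  by rewrite int_xx !subrr !mulr0 addr0.
- move=> x y z xy yz Pxy Pyz ax zb u v xu uv vz FH.
  have ay : a <= y by exact: le_trans xy.
  have yb : y <= b by exact: le_trans zb.
  have [vy|yv] := leP v y; first exact: Pxy.
  have [yu|uy] := leP y u; first exact: Pyz.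
  rewrite (ge0_integral_itv_glue (ltW uy) (ltW yv)); last first.
    apply: measurable_funS mF => //.
    apply: subset_itv; rewrite bnd_simp; first exact: le_trans xu.
    exact: le_trans zb.
  have -> : al * (p.1 v - p.1 u) + be * (p.2 v - p.2 u) =
    (al * (p.1 y - p.1 u) + be * (p.2 y - p.2 u)) +
    (al * (p.1 v - p.1 y) + be * (p.2 v - p.2 y)) by ring.
  rewrite EFinD; apply: leeD.
    apply: Pxy => // [|s]; first exact: ltW.
    rewrite in_itv /= => /andP[us sy]; apply: FH.
    by rewrite in_itv /= us (lt_trans sy).
  apply: Pyz => // [|s]; first exact: ltW.
  rewrite in_itv /= => /andP[ys sv]; apply: FH.
  by rewrite in_itv /= sv (lt_trans uy).
- move=> x y xy ax yb [g1 cg1 fg1] [g2 cg2 fg2] _ _ u v xu uv vy FH.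
  move: uv; rewrite le_eqVlt => /orP[/eqP <-|uv].
    by rewrite int_xx !subrr !mulr0 addr0.
  have sub_xy : `[u, v] `<=` `[x, y] by apply: subset_itv; rewrite bnd_simp.
  have sub_ab : `[u, v] `<=` `[a, b].
    apply: subset_itv; rewrite bnd_simp; first exact: le_trans xu.
    exact: le_trans yb.
  have uvP s : s \in `]u, v[ -> s \in `]x, y[.
    rewrite !in_itv /= => /andP[us sv].
    by rewrite (le_lt_trans xu) // (lt_le_trans sv).
  have uvab s : s \in `]u, v[ -> s \in `]a, b[.
    move=> /uvP; rewrite !in_itv /= => /andP[us sv].
    by rewrite (le_lt_trans ax) // (lt_le_trans sv).
  pose G : R -> R := fun s => al * g1 s + be * g2 s.
  pose f : R -> R := fun s => al * p.1 s + be * p.2 s.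
  have cG : {within `[u, v], continuous G}.
    move=> s; apply: cvgD; apply: cvgMr.
      exact: (continuous_subspaceW sub_xy cg1).
    exact: (continuous_subspaceW sub_xy cg2).
  have cf : {within `[u, v], continuous f}.
    move=> s; apply: cvgD; apply: cvgMr.
      exact: (continuous_subspaceW sub_ab c1).
    exact: (continuous_subspaceW sub_ab c2).
  have fG s : s \in `]u, v[ -> is_derive s 1 f (G s).
    move=> /uvP sxy; have ? := fg1 _ sxy; have ? := fg2 _ sxy.
    exact: is_deriveD.
  have FG s : s \in `]u, v[ -> F s <= G s.
    move=> suv; have := FH _ suv.
    rewrite (derive1_C1 fg1 (uvP _ suv)) (derive1_C1 fg2 (uvP _ suv)).
    have [d1 e1] := fg1 _ (uvP _ suv); have [d2 e2] := fg2 _ (uvP _ suv).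
    have [] := p'_ge0 _ (uvab _ suv) d1 d2.
    by rewrite !derive1E e1 e2 => ? ?; apply.
  have -> : al * (p.1 v - p.1 u) + be * (p.2 v - p.2 u) = f v - f u.
    by rewrite /f; ring.
  have dfuv : derivable_oo_LRcontinuous f u v.
    have [_ fu fv] := (continuous_within_itvP _ uv).1 cf.
    by split => // s /fG[].
  rewrite EFinB -(continuous_FTC2 uv cG dfuv (derive1_C1 fG)).
  have mFuv : measurable_fun `]u, v[ (EFin \o F).
    apply/measurable_EFinP; apply: measurable_funS mF => //.
    by apply: subset_trans sub_ab; exact: subset_itv_oo_cc.
  have mG : measurable_fun `]u, v[ (EFin \o G).
    apply/measurable_EFinP; apply: subspace_continuous_measurable_fun => //.
    by apply: (continuous_subspaceW _ cG); exact: subset_itv_oo_cc.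
  rewrite (integral_itv_bndoo _ _ mFuv) (integral_itv_bndoo _ _ mG).
  by apply: ge0_le_integral => //= s _; rewrite lee_fin.
Qed.

(** * Passage times along general paths *)

Lemma gamE {R : realType} (u v : R) : 0 <= u -> 0 <= v ->
  gam u v = u + v + 2 * (Num.sqrt u * Num.sqrt v).
Proof. by move=> u0 v0; rewrite /gam sqrrD !sqr_sqrtr //; ring. Qed.

Lemma gam_ge0 {R : realType} (u v : R) : 0 <= gam u v.
Proof. exact: sqr_ge0. Qed.

Lemma gam00 {R : realType} : gam 0 0 = 0 :> R.
Proof. by rewrite /gam sqrtr0 addr0 expr0n. Qed.

Lemma gamZ {R : realType} (k u v : R) : 0 <= k ->
  gam (k * u) (k * v) = k * gam u v.
Proof.
by move=> k0; rewrite /gam !sqrtrM // -mulrDr exprMn sqr_sqrtr.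
Qed.

(** The defect is [t^-1 * (t * sqrt u - sqrt v)^2], so equality holds on the ray [v = t^2 * u]. *)
Lemma gam_le_tangent {R : realType} (t u v : R) : 0 < t -> 0 <= u -> 0 <= v ->
  gam u v <= (1 + t) * u + (1 + t^-1) * v.
Proof.
move=> t0 u0 v0; rewrite gamE // -subr_ge0.
have -> : (1 + t) * u + (1 + t^-1) * v - (u + v + 2 * (Num.sqrt u * Num.sqrt v))
    = t^-1 * (t * Num.sqrt u - Num.sqrt v) ^+ 2.
  rewrite -{1 2}(sqr_sqrtr u0) -{1 2}(sqr_sqrtr v0).
  by field; rewrite gt_eqF.
by rewrite mulr_ge0 ?sqr_ge0 // invr_ge0 ltW.
Qed.

Lemma gam_tangent_eq {R : realType} (t v : R) : 0 < t -> 0 <= v ->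
  gam v (t ^+ 2 * v) = (1 + t) * v + (1 + t^-1) * (t ^+ 2 * v).
Proof.
move=> t0 v0; have tv0 : 0 <= t ^+ 2 * v by rewrite mulr_ge0 ?sqr_ge0.
rewrite (gamE v0 tv0) sqrtrM ?sqr_ge0 //.
rewrite sqrtr_sqr gtr0_norm // (mulrCA (Num.sqrt v)) -expr2 sqr_sqrtr //.
by field; rewrite gt_eqF.
Qed.

(* When [u] or [v] vanishes the infimum over [t] of the tangents is not
   attained, hence the perturbation [d]. *)
Lemma le_gam_tangent {R : realType} (X u v : R) : 0 <= u -> 0 <= v ->
  (forall t, 0 < t -> X <= (1 + t) * u + (1 + t^-1) * v) -> X <= gam u v.
Proof.
move=> u0 v0 HX; apply/ler_addgt0Pr => e e0.
set a := Num.sqrt u; set b := Num.sqrt v.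
have a0 : 0 <= a by exact: sqrtr_ge0.
have b0 : 0 <= b by exact: sqrtr_ge0.
pose d := e / (a + b + 1).
have ab1 : 0 < a + b + 1 by lra.
have d0 : 0 < d by rewrite divr_gt0.
have ad : 0 < a + d by lra.
have bd : 0 < b + d by lra.
(* The minimizing slope would be [b / a]; shifting both terms by [d] costs at most
   [d * (a + b) <= e]. *)
apply: le_trans (HX ((b + d) / (a + d)) _) _; first by rewrite divr_gt0.
rewrite gamE // -/a -/b.
have ua : u = a ^+ 2 by rewrite sqr_sqrtr.
have vb : v = b ^+ 2 by rewrite sqr_sqrtr.
have le1 : (b + d) / (a + d) * u <= (b + d) * a.
  rewrite -mulrA ler_wpM2l ?(ltW bd) // mulrC ler_pdivrMr // ua.
  by nra.
have le2 : ((b + d) / (a + d))^-1 * v <= (a + d) * b.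
  rewrite invf_div -mulrA ler_wpM2l ?(ltW ad) // mulrC ler_pdivrMr // vb.
  by nra.
have le3 : d * (a + b) <= e.
  by rewrite /d mulrAC ler_pdivrMr //; nra.
by nra.
Qed.

(** An infimum of linear functions is superadditive. *)
Lemma gam_superadditive {R : realType} (u v u' v' : R) :
  0 <= u -> 0 <= v -> 0 <= u' -> 0 <= v' ->
  gam u v + gam u' v' <= gam (u + u') (v + v').
Proof.
move=> u0 v0 u'0 v'0; apply: le_gam_tangent; rewrite ?addr_ge0 // => t t0.
have := gam_le_tangent t0 u0 v0; have := gam_le_tangent t0 u'0 v'0.
by lra.
Qed.

Lemma c_ell_ge {R : realType} (lambda r u v : R) : r <= 1 ->
  r <= c_ell lambda r u v.
Proof. by move=> r1; rewrite /c_ell; case: ifP. Qed.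

Lemma c_ell_le1 {R : realType} (lambda r u v : R) : r <= 1 ->
  c_ell lambda r u v <= 1.
Proof. by move=> r1; rewrite /c_ell; case: ifP. Qed.

(** The increment bound for the zero function, with coefficients [(1, 0)] and [(0, 1)], carries
    monotonicity across the breakpoints. *)
Lemma path_ndec {R : realType} (x y u v : R) (p : (R -> R) * (R -> R)) :
  paths x y p -> 0 <= u -> u <= v -> v <= 1 ->
  p.1 u <= p.1 v /\ p.2 u <= p.2 v.
Proof.
move=> [[c1 c2] pC1 _ _ p'_ge0] u0 uv v1.
have H al be : 0 <= al -> 0 <= be ->
    0 <= al * (p.1 v - p.1 u) + be * (p.2 v - p.2 u).
  move=> al0 be0.
  have := @integral_le_increment _ p (cst 0) al be 0 1 c1 c2 pC1 p'_ge0
    (measurable_cst _) (fun=> lexx 0) u v u0 uv v1.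
  rewrite integral0 lee_fin; apply=> s _ d1 d2.
  by rewrite addr_ge0 // mulr_ge0.
have := H 1 0 ler01 (lexx 0); have := H 0 1 (lexx 0) ler01.
by split; lra.
Qed.

Definition path_rate {R : realType} (lambda r : R) (p : (R -> R) * (R -> R))
    (s : R) : R :=
  gam (derive1 p.1 s) (derive1 p.2 s) / c_ell lambda r (p.1 s) (p.2 s).

Lemma path_rate_ge0 {R : realType} (lambda r : R) p s : 0 < r -> r <= 1 ->
  0 <= path_rate lambda r p s.
Proof.
move=> r0 r1; rewrite /path_rate divr_ge0 ?gam_ge0 //.
exact: le_trans (ltW r0) (c_ell_ge _ _ _ r1).
Qed.

Lemma measurable_path_rate {R : realType} (lambda r x y : R) p :
  paths x y p -> measurable_fun `[(0 : R), 1] (path_rate lambda r p).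
Proof.
move=> [[c1 c2] pC1 _ _ _].
have [m1 m2] := measurable_derive1_piecewise pC1.
have msqrt (f : R -> R) : measurable_fun `[(0 : R), 1] f ->
    measurable_fun `[(0 : R), 1] (Num.sqrt \o f).
  move=> mf; apply: measurableT_comp mf.
  by apply: continuous_measurable_fun; exact: sqrt_continuous.
apply: measurable_funM.
  rewrite (_ : (fun s => _) =
    (fun s => ((Num.sqrt \o derive1 p.1) s +
               (Num.sqrt \o derive1 p.2) s) ^+ 2)) //.
  by apply: measurable_funX; apply: measurable_funD; exact: msqrt.
rewrite (_ : (fun s => _) =
    (fun s => if p.1 s - lambda < p.2 s then 1 else r^-1)); last first.
  by apply/funext => s; rewrite /c_ell; case: ifP; rewrite ?invr1.
apply: measurable_fun_if => //.
by apply: measurable_fun_ltr; [apply: measurable_funB => //|];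
  exact: subspace_continuous_measurable_fun.
Qed.

(** Each tangent bounds the rate linearly in the derivatives and integrates to the same tangent at
    the increments; the infimum over [t] restores [gam]. *)
Lemma integral_path_rate_le {R : realType} (lambda r x y k u v : R) p :
  0 < r -> r <= 1 -> paths x y p -> 0 <= u -> u <= v -> v <= 1 -> 0 < k ->
  (forall s, s \in `]u, v[ -> k <= c_ell lambda r (p.1 s) (p.2 s)) ->
  (\int[lebesgue_measure]_(s in `[u, v]) (path_rate lambda r p s)%:E <=
     (k^-1 * gam (p.1 v - p.1 u) (p.2 v - p.2 u))%:E)%E.
Proof.
move=> r0 r1 hp u0 uv v1 k0 ck.
have [i1 i2] := path_ndec hp u0 uv v1.
set I := (X in (X <= _)%E).
have I0 : (0 <= I)%E.
  by apply: integral_ge0 => s _; rewrite lee_fin path_rate_ge0.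
have IT t : 0 < t -> (I <= (k^-1 *
    ((1 + t) * (p.1 v - p.1 u) + (1 + t^-1) * (p.2 v - p.2 u)))%:E)%E.
  move=> t0; rewrite mulrDr !mulrA.
  have mF := measurable_path_rate lambda r hp.
  have [[c1 c2] pC1 _ _ p'_ge0] := hp.
  apply: (integral_le_increment c1 c2 pC1 p'_ge0 mF) => // [s|s suv d1 d2].
    exact: path_rate_ge0.
  rewrite -!mulrA -mulrDr mulrC /path_rate.
  apply: ler_pM; rewrite ?gam_ge0 ?invr_ge0 //.
  - exact: le_trans (ltW r0) (c_ell_ge _ _ _ r1).
  - exact: gam_le_tangent.
  - by rewrite lef_pV2 ?ck // posrE // (lt_le_trans k0) ?ck.
(* The bound at [t = 1] makes the integral finite, so the infimum over [t] can be taken in the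
   reals. *)
have Ifin : I \is a fin_num.
  rewrite ge0_fin_numE //; apply: le_lt_trans (IT 1 ltr01) _; exact: ltry.
rewrite -(fineK Ifin) lee_fin ler_pdivlMl //.
apply: le_gam_tangent; rewrite ?subr_ge0 // => t t0.
by rewrite -ler_pdivlMl // -lee_fin fineK // IT.
Qed.

(** * Cutting a path at the line *)

(** The times are the minimum and maximum of the compact set where [d <= 0]. Were [d u] negative,
    the intermediate value theorem on [[0, u]] would give an earlier zero; the same argument on
    [[v, 1]] needs [0 <= d 1]. *)
Lemma nonpositivity_extremes {R : realType} (d : R -> R) :
  {within `[0, 1], continuous d} -> 0 <= d 0 ->
  (exists2 s, s \in `[0, 1] & d s <= 0) ->
  exists u v, [/\ [/\ 0 <= u, u <= v & v <= 1], d u = 0, 0 <= d 1 -> d v = 0,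
    forall s, s \in `]0, u[ -> 0 < d s & forall s, s \in `]v, 1[ -> 0 < d s].
Proof.
move=> cd d0 [s0 s01 ds0].
pose K : set R := [set s | d s <= 0] `&` `[0, 1].
have K0 : K !=set0 by exists s0; split.
have cK : compact K.
  (* The interval is doubled: one copy supplies compactness, the other turns closedness in the
     subspace into closedness in the reals. *)
  have -> : K = `[0, 1] `&` [set` `[0, 1]] `&` [set s | d s <= 0].
    by rewrite setIid setIC.
  rewrite -setIA; apply: compact_closedI; first exact: segment_compact.
  rewrite setIC closed_setIS; last exact: itv_closed.
  exact: ((continuous_closedP (d : subspace `[0, 1] -> R)).1 cd
    [set z | z <= 0] (@closed_le _ 0)).
have cid : {within K, continuous (@idfun R)}.
  by apply: continuous_subspaceT => s; exact: cvg_id.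
have [u uK umin] := compact_EVT_min K0 cK cid.
have [v vK vmax] := compact_EVT_max K0 cK cid.
move: (uK) (vK); rewrite !inE /K /= !in_itv /=.
move=> [du /andP[u0 u1]] [dv /andP[v0 v1]].
have posd s : 0 <= s <= 1 -> s \notin K -> 0 < d s.
  move=> s01'; rewrite ltNge; apply: contra => ds.
  by rewrite inE; split => //=; rewrite in_itv.
exists u, v; split => //.
- by split => //; exact: umin vK.
- apply/le_anti; rewrite du /= leNgt; apply/negP => du0.
  have cd0u : {within `[0, u], continuous d}.
    by apply: continuous_subspaceW cd; apply: subset_itv; rewrite bnd_simp.
  have [|w] := @IVT _ d 0 u 0 u0 cd0u _.
    by rewrite ge_min du orbT le_max d0.
  rewrite in_itv /= => /andP[w0 wu] dw.
  have wK : w \in K.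
    by rewrite inE; split; rewrite /= ?dw // in_itv /= w0 (le_trans wu).
  have uw : u = w by apply/le_anti; rewrite wu (umin _ wK).
  by rewrite uw dw ltxx in du0.
- move=> d1; apply/le_anti; rewrite dv /= leNgt; apply/negP => dv0.
  have cdv1 : {within `[v, 1], continuous d}.
    by apply: continuous_subspaceW cd; apply: subset_itv; rewrite bnd_simp.
  have [|w] := @IVT _ d v 1 0 v1 cdv1 _.
    by rewrite ge_min dv le_max d1 orbT.
  rewrite in_itv /= => /andP[vw w1] dw.
  have wK : w \in K.
    by rewrite inE; split; rewrite /= ?dw // in_itv /= w1 (le_trans v0).
  have vw' : v = w by apply/le_anti; rewrite vw (vmax _ wK).
  by rewrite vw' dw ltxx in dv0.
- move=> s; rewrite in_itv /= => /andP[s0' su]; apply: posd.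
    by rewrite ltW //= (le_trans (ltW su)).
  by apply/negP => /umin /=; rewrite leNgt su.
- move=> s; rewrite in_itv /= => /andP[vs s1]; apply: posd.
    by rewrite (le_trans v0) ?ltW.
  by apply/negP => /vmax /=; rewrite leNgt vs.
Qed.

Lemma line_gap_continuous {R : realType} (lambda x y : R) p : paths x y p ->
  {within `[0, 1], continuous (fun s => p.2 s - p.1 s + lambda)}.
Proof.
move=> [[c1 c2] _ _ _ _] s.
by apply: cvgD; [apply: cvgB; [exact: c2|exact: c1]|exact: cvg_cst].
Qed.

Lemma path_time_split {R : realType} (lambda r x y u v : R) p :
  0 < r -> r <= 1 -> paths x y p -> 0 <= u -> u <= v -> v <= 1 ->
  (path_time (c_ell lambda r) p =
  \int[lebesgue_measure]_(s in `[0%R, u]) (path_rate lambda r p s)%:E +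
  \int[lebesgue_measure]_(s in `[u, v]) (path_rate lambda r p s)%:E +
  \int[lebesgue_measure]_(s in `[v, 1%R]) (path_rate lambda r p s)%:E)%E.
Proof.
move=> r0 r1 hp u0 uv v1; have mF := measurable_path_rate lambda r hp.
rewrite /path_time (ge0_integral_itv_glue (f := path_rate lambda r p) _ v1) //;
  last exact: le_trans uv.
rewrite (ge0_integral_itv_glue u0 uv) //.
by apply: measurable_funS mF => //; apply: subset_itv; rewrite bnd_simp.
Qed.

(** The first alternative is a path strictly above the line at all times. Otherwise the cuts are the
    extreme times on the line: the speed is [1] outside them, and between them only [r <= c_ell] is
    used. *)
Lemma path_time_above_line {R : realType} (lambda r x y : R) p :
  0 <= lambda -> 0 < r -> r < 1 -> x - lambda <= y -> paths x y p ->
  (path_time (c_ell lambda r) p <= (gam x y)%:E)%E \/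
  exists a b, [/\ lambda <= a, a <= b, b <= x, b <= y + lambda &
    (path_time (c_ell lambda r) p <=
      (gam a (a - lambda) + 4 / r * (b - a) +
       gam (x - b) (y - b + lambda))%:E)%E].
Proof.
move=> l0 r0 r1 xy hp; have r1' := ltW r1.
have [_ _ p_ge0 [p10 p20 p11 p21] _] := hp.
pose d s := p.2 s - p.1 s + lambda.
have cd : {within `[0, 1], continuous d} by exact: line_gap_continuous hp.
have c1 s : 0 < d s -> c_ell lambda r (p.1 s) (p.2 s) = 1.
  by rewrite /c_ell /d => ds; rewrite ifT //; lra.
have [hit|dpos] := pselect (exists2 s, s \in `[0, 1] & d s <= 0); last first.
  left; have := @integral_path_rate_le _ lambda r x y 1 0 1 p r0 r1' hp.
  rewrite lexx ler01 ltr01 p10 p20 p11 p21 !subr0 invr1 mul1r.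
  apply=> // s s01; rewrite c1 // ltNge; apply/negP => ds.
  by apply: dpos; exists s => //; exact: subset_itv_oo_cc.
right.
have d0 : 0 <= d 0 by rewrite /d p10 p20 subrr add0r.
have [u [v [[u0 uv v1] du dv before after]]] :=
  nonpositivity_extremes cd d0 hit.
have u1 := le_trans uv v1; have v0 := le_trans u0 uv.
have dv0 : d v = 0 by apply: dv; rewrite /d p11 p21; lra.
have [pu1 pu2] : 0 <= p.1 u /\ 0 <= p.2 u by apply: p_ge0; rewrite in_itv /= u0.
have [uv1 uv2] := path_ndec hp u0 uv v1.
have [vx vy] : p.1 v <= x /\ p.2 v <= y.
  by rewrite -p11 -p21; exact: path_ndec hp v0 v1 (lexx 1).
have e2u : p.2 u = p.1 u - lambda by move: du; rewrite /d => ?; lra.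
have e2v : p.2 v = p.1 v - lambda by move: dv0; rewrite /d => ?; lra.
exists (p.1 u), (p.1 v); split => //; [lra|lra|].
rewrite (path_time_split lambda r0 r1' hp u0 uv v1) !EFinD.
apply: leeD; first apply: leeD.
- have := @integral_path_rate_le _ lambda r x y 1 0 u p r0 r1' hp.
  rewrite p10 p20 !subr0 invr1 mul1r e2u; apply => // s su.
  by rewrite c1 // before.
- have := @integral_path_rate_le _ lambda r x y r u v p r0 r1' hp u0 uv v1 r0.
  (* Both cuts lie on the line, so the two coordinates grow equally, and [gam] of equal arguments is
     four times their common value. *)
  have -> : p.2 v - p.2 u = p.1 v - p.1 u by rewrite e2u e2v; ring.
  have -> : 4 / r * (p.1 v - p.1 u) =
      r^-1 * gam (p.1 v - p.1 u) (p.1 v - p.1 u).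
    rewrite gamE ?subr_ge0 // -expr2 sqr_sqrtr ?subr_ge0 //.
    by field; rewrite gt_eqF.
  by apply => s _; exact: c_ell_ge.
- have := @integral_path_rate_le _ lambda r x y 1 v 1 p r0 r1' hp.
  have -> : y - p.1 v + lambda = y - p.2 v by rewrite e2v; ring.
  rewrite p11 p21 invr1 mul1r; apply => // s sv.
  by rewrite c1 // after.
Qed.

(** The endpoint is below the line, so a first meeting time exists; after it the bound [r <= c_ell]
    suffices, whether or not the path returns above. *)
Lemma path_time_below_line {R : realType} (lambda r x y : R) p :
  0 <= lambda -> 0 < r -> r < 1 -> y < x - lambda -> paths x y p ->
  exists2 a, lambda <= a <= y + lambda &
    (path_time (c_ell lambda r) p <= (crossing lambda r x y a)%:E)%E.
Proof.
move=> l0 r0 r1 xy hp; have r1' := ltW r1.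
have [_ _ p_ge0 [p10 p20 p11 p21] _] := hp.
pose d s := p.2 s - p.1 s + lambda.
have cd : {within `[0, 1], continuous d} by exact: line_gap_continuous hp.
have d0 : 0 <= d 0 by rewrite /d p10 p20 subrr add0r.
have [|u [v [[u0 uv v1] du _ before _]]] := nonpositivity_extremes cd d0 _.
  by exists 1; rewrite ?in_itv /= ?lexx ?ler01 // /d p11 p21; lra.
have u1 := le_trans uv v1.
have [pu1 pu2] : 0 <= p.1 u /\ 0 <= p.2 u by apply: p_ge0; rewrite in_itv /= u0.
have [ux uy] : p.1 u <= x /\ p.2 u <= y.
  by rewrite -p11 -p21; exact: path_ndec hp u0 u1 (lexx 1).
have e2u : p.2 u = p.1 u - lambda by move: du; rewrite /d => ?; lra.
exists (p.1 u); first by apply/andP; split; lra.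
rewrite (path_time_split lambda r0 r1' hp u0 u1 (lexx 1)).
rewrite [X in (_ + X)%E](_ : _ = 0%E) ?adde0; last first.
  by rewrite set_itv1 integral_set1.
rewrite /crossing EFinD; apply: leeD.
- have := @integral_path_rate_le _ lambda r x y 1 0 u p r0 r1' hp.
  rewrite p10 p20 !subr0 invr1 mul1r e2u; apply => // s su.
  rewrite /c_ell ifT //; have := before s su; rewrite /d; lra.
- have := @integral_path_rate_le _ lambda r x y r u 1 p r0 r1' hp u0 u1
    (lexx 1) r0.
  have -> : y - p.1 u + lambda = y - p.2 u by rewrite e2u; ring.
  by rewrite p11 p21; apply => s _; exact: c_ell_ge.
Qed.

(** * Broken lines *)

Lemma nondecreasing_derive1_ge0 {R : realType} (f : R -> R) (s : R) :
  {homo f : x y / x <= y} -> derivable f s 1 -> 0 <= derive1 f s.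
Proof.
move=> fnd df; rewrite derive1E /derive; apply: limr_ge => //.
apply: nearW => h /=; rewrite /shift /= scaler1 /GRing.scale /=.
have [h0|h0] := leP 0 h.
  by rewrite mulr_ge0 ?invr_ge0 // subr_ge0 fnd // lerDr.
by rewrite mulr_le0 ?invr_le0 ?(ltW h0) // subr_le0 fnd // gerDr ltW.
Qed.

Lemma is_derive_affine {R : realType} (f : R -> R) (u v m n : R) :
  (forall s, s \in `[u, v] -> f s = m * s + n) ->
  forall s, s \in `]u, v[ -> is_derive s 1 f m.
Proof.
move=> fE s suv.
apply: (@near_eq_is_derive _ _ _ (fun t => m * t + n)).
  have : \forall t \near s, t \in `]u, v[ by exact: near_in_itvoo.
  by apply: filterS => t tuv; rewrite fE //; exact: subset_itv_oo_cc.
by apply: is_derive_eq; rewrite /GRing.scale /= mulr1 addr0.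
Qed.

Lemma C1_on_affine {R : realType} (f : R -> R) (u v m n : R) :
  (forall s, s \in `[u, v] -> f s = m * s + n) -> C1_on f u v.
Proof.
move=> fE; exists (cst m); last exact: is_derive_affine fE.
by apply: continuous_subspaceT => s; exact: cvg_cst.
Qed.

(** Piecewise affine with values [0, a, b, c] at times [0, 1/3, 2/3, 1]. The [min]/[max] form gives
    continuity and monotonicity term by term. *)
Definition broken_line {R : realType} (a b c s : R) : R :=
  a * Num.min (3 * s) 1 + (b - a) * Num.max 0 (Num.min (3 * s - 1) 1) +
  (c - b) * Num.max 0 (3 * s - 2).

(** The trailing [+ 0] matches the shape [m * s + n] of the affine lemmas. *)
Lemma broken_line1 {R : realType} (a b c s : R) : s \in `[0, 1 / 3] ->
  broken_line a b c s = 3 * a * s + 0.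
Proof.
rewrite in_itv /= => /andP[s0 s1]; rewrite /broken_line.
rewrite min_l; last by lra.
rewrite [Num.min _ _]min_l; last by lra.
by rewrite !max_l; [ring|lra|lra].
Qed.

Lemma broken_line2 {R : realType} (a b c s : R) : s \in `[1 / 3, 2 / 3] ->
  broken_line a b c s = 3 * (b - a) * s + (2 * a - b).
Proof.
rewrite in_itv /= => /andP[s0 s1]; rewrite /broken_line.
rewrite min_r; last by lra.
rewrite [Num.min _ _]min_l; last by lra.
by rewrite max_r; [rewrite max_l; [ring|lra]|lra].
Qed.

Lemma broken_line3 {R : realType} (a b c s : R) : s \in `[2 / 3, 1] ->
  broken_line a b c s = 3 * (c - b) * s + (3 * b - 2 * c).
Proof.
rewrite in_itv /= => /andP[s0 s1]; rewrite /broken_line.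
rewrite min_r; last by lra.
rewrite [Num.min _ _]min_r; last by lra.
by rewrite !max_r; [ring|lra|lra].
Qed.

Lemma broken_line_ndec {R : realType} (a b c : R) :
  0 <= a -> a <= b -> b <= c -> {homo broken_line a b c : s t / s <= t}.
Proof.
move=> a0 ab bc s t st; rewrite /broken_line.
have mon (k : R) : Num.min (3 * s - k) 1 <= Num.min (3 * t - k) 1.
  by rewrite le_min !ge_min lexx orbT andbT; apply/orP; left; lra.
apply: lerD; first apply: lerD; apply: ler_wpM2l; rewrite ?subr_ge0 //.
- by have := mon 0; rewrite !subr0.
- by rewrite ge_max !le_max lexx mon orbT.
- by rewrite ge_max !le_max lexx /=; apply/orP; right; lra.
Qed.

Lemma broken_line_continuous {R : realType} (a b c : R) :
  continuous (broken_line a b c).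
Proof.
move=> s.
have cvg_max0 (f : R -> R) : f t @[t --> s] --> f s ->
    Num.max 0 (f t) @[t --> s] --> Num.max 0 (f s).
  move=> cf; apply: (@continuous2_cvg _ R R R _ _ (cst 0) f Num.max) => //.
  - exact: (@max_continuous _ R (0, f s)).
  - exact: cvg_cst.
have cvg_min1 (f : R -> R) : f t @[t --> s] --> f s ->
    Num.min (f t) 1 @[t --> s] --> Num.min (f s) 1.
  move=> cf; apply: (@continuous2_cvg _ R R R _ _ f (cst 1) Num.min) => //.
  - exact: (@min_continuous _ R (f s, 1)).
  - exact: cvg_cst.
have c3 : 3 * t @[t --> s] --> 3 * s by apply: cvgMr; exact: cvg_id.
have caff k : 3 * t - k @[t --> s] --> 3 * s - k.
  by apply: cvgB => //; exact: cvg_cst.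
apply: cvgD; first apply: cvgD; apply: cvgMr.
- exact: cvg_min1.
- apply: (cvg_max0 (fun t => Num.min (3 * t - 1) 1)).
  exact: (cvg_min1 (fun t => 3 * t - 1)).
- exact: (cvg_max0 (fun t => 3 * t - 2)).
Qed.

Lemma broken_line_path {R : realType} (x1 x2 x3 y1 y2 y3 : R) :
  0 <= x1 -> x1 <= x2 -> x2 <= x3 -> 0 <= y1 -> y1 <= y2 -> y2 <= y3 ->
  paths x3 y3 (broken_line x1 x2 x3, broken_line y1 y2 y3).
Proof.
move=> x1_0 x12 x23 y1_0 y12 y23.
have at0 (a b c : R) : broken_line a b c 0 = 0.
  by rewrite broken_line1 ?in_itv /= ?lexx ?divr_ge0 // mulr0 addr0.
have at1 (a b c : R) : broken_line a b c 1 = c.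
  by rewrite broken_line3 ?in_itv /=; [ring|apply/andP; split; lra].
split => /=.
- by split; apply: continuous_subspaceT; exact: broken_line_continuous.
- exists [:: 1 / 3; 2 / 3; 1].
    split => //=; apply/and4P; split => //; lra.
  move=> [|[|[|//]]] _ /=; split.
  + exact: C1_on_affine (@broken_line1 R _ _ _).
  + exact: C1_on_affine (@broken_line1 R _ _ _).
  + exact: C1_on_affine (@broken_line2 R _ _ _).
  + exact: C1_on_affine (@broken_line2 R _ _ _).
  + exact: C1_on_affine (@broken_line3 R _ _ _).
  + exact: C1_on_affine (@broken_line3 R _ _ _).
- move=> s; rewrite in_itv /= => /andP[s0 _].
  split; [rewrite -(at0 x1 x2 x3)|rewrite -(at0 y1 y2 y3)];
    exact: broken_line_ndec.
- by split; rewrite ?at0 ?at1.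
- by move=> s _ d1 d2; split; apply: nondecreasing_derive1_ge0 => //;
    exact: broken_line_ndec.
Qed.

(** * Lower bounds from broken lines *)

Lemma integral_itv_ge_cst {R : realType} (F : R -> R) (u v K : R) :
  u <= v -> 0 <= K -> measurable_fun `[u, v] F ->
  (forall s, 0 <= F s) -> (forall s, s \in `]u, v[ -> K <= F s) ->
  ((K * (v - u))%:E <= \int[lebesgue_measure]_(s in `[u, v]) (F s)%:E)%E.
Proof.
move=> uv K0 mF F0 KF.
have mFo : measurable_fun `]u, v[ (EFin \o F).
  apply/measurable_EFinP; apply: measurable_funS mF => //.
  exact: subset_itv_oo_cc.
rewrite (integral_itv_bndoo _ _ mFo).
have -> : ((K * (v - u))%:E =
    \int[lebesgue_measure]_(s in `]u, v[) (cst K%:E s))%E.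
  rewrite integral_cst //= lebesgue_measure_itv /= lte_fin.
  case: ltP => [_|vu]; first by rewrite EFinM EFinB.
  by rewrite (@le_anti _ _ u v) ?uv // subrr mulr0 mule0.
by apply: ge0_le_integral => //= s suv; rewrite lee_fin.
Qed.

(** The derivatives are constant on the stretch, and homogeneity of [gam] absorbs its duration. *)
Lemma path_time_affine_ge {R : realType}
    (lambda r x y k u v m1 n1 m2 n2 : R) p :
  0 < r -> r <= 1 -> paths x y p -> 0 <= u -> u <= v -> v <= 1 ->
  (forall s, s \in `[u, v] -> p.1 s = m1 * s + n1) ->
  (forall s, s \in `[u, v] -> p.2 s = m2 * s + n2) ->
  0 < k -> (forall s, s \in `]u, v[ -> c_ell lambda r (p.1 s) (p.2 s) <= k) ->
  ((k^-1 * gam (m1 * (v - u)) (m2 * (v - u)))%:E <=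
   \int[lebesgue_measure]_(s in `[u, v]) (path_rate lambda r p s)%:E)%E.
Proof.
move=> r0 r1 hp u0 uv v1 E1 E2 k0 ck.
rewrite ![_ * (v - u)]mulrC gamZ ?subr_ge0 // (mulrC (v - u)) mulrA.
apply: integral_itv_ge_cst => //.
- by rewrite mulr_ge0 ?gam_ge0 // invr_ge0 ltW.
- apply: measurable_funS (measurable_path_rate lambda r hp) => //.
  by apply: subset_itv; rewrite bnd_simp.
- by move=> s; exact: path_rate_ge0.
move=> s suv; rewrite /path_rate mulrC !derive1E.
have [_ ->] := is_derive_affine E1 suv; have [_ ->] := is_derive_affine E2 suv.
rewrite ler_wpM2l ?gam_ge0 // lef_pV2 ?ck // posrE.
exact: lt_le_trans (c_ell_ge _ _ _ r1).
Qed.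

(** Source of all lower bounds. The outer segments use only [c_ell <= 1], so only the position of
    the middle one has to be controlled. *)
Lemma Gam_ge_broken_line {R : realType} (lambda r k x1 x2 x3 y1 y2 y3 : R) :
  0 < r -> r <= 1 ->
  0 <= x1 -> x1 <= x2 -> x2 <= x3 -> 0 <= y1 -> y1 <= y2 -> y2 <= y3 ->
  0 < k ->
  (forall h, 0 <= h <= 1 ->
     c_ell lambda r (x1 + h * (x2 - x1)) (y1 + h * (y2 - y1)) <= k) ->
  ((gam x1 y1 + k^-1 * gam (x2 - x1) (y2 - y1) + gam (x3 - x2) (y3 - y2))%:E
    <= Gam (c_ell lambda r) x3 y3)%E.
Proof.
move=> r0 r1 x1_0 x12 x23 y1_0 y12 y23 k0 ck.
have hp := broken_line_path x1_0 x12 x23 y1_0 y12 y23.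
apply: le_trans (ereal_sup_ubound _); last first.
  by exists (broken_line x1 x2 x3, broken_line y1 y2 y3).
rewrite (@path_time_split _ lambda r _ _ (1 / 3) (2 / 3) _ r0 r1 hp);
  [|lra|lra|lra].
have c1 : 0 <= (1 / 3 : R) by lra.
have c2 : 1 / 3 <= (2 / 3 : R) by lra.
have c3 : 2 / 3 <= (1 : R) by lra.
have c4 : 1 / 3 <= (1 : R) by lra.
have c5 : 0 <= (2 / 3 : R) by lra.
rewrite !EFinD; apply: leeD; first apply: leeD.
- have := path_time_affine_ge (k := 1) (lambda := lambda) r0 r1 hp
    (lexx 0) c1 c4
    (@broken_line1 _ _ _ _) (@broken_line1 _ _ _ _) ltr01
    (fun s _ => c_ell_le1 _ _ _ r1).
  rewrite invr1 mul1r (_ : 3 * x1 * _ = x1); last by field.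
  by rewrite (_ : 3 * y1 * _ = y1); last by field.
- have := @path_time_affine_ge _ lambda r _ _ k _ _ _ _ _ _ _ r0 r1 hp c1 c2 c3
    (@broken_line2 _ _ _ _) (@broken_line2 _ _ _ _) k0.
  rewrite (_ : 3 * (x2 - x1) * _ = x2 - x1); last by field.
  rewrite (_ : 3 * (y2 - y1) * _ = y2 - y1); last by field.
  apply => s ss; have ss' := subset_itv_oo_cc ss.
  rewrite /= !broken_line2 //.
  (* Time [s] in the middle third is position [h = 3 * s - 1] on the middle segment. *)
  have := ck (3 * s - 1); move: ss; rewrite in_itv /= => /andP[s1 s2] ck'.
  rewrite (_ : 3 * (x2 - x1) * s + (2 * x1 - x2) =
    x1 + (3 * s - 1) * (x2 - x1)); last by ring.
  rewrite (_ : 3 * (y2 - y1) * s + (2 * y1 - y2) =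
    y1 + (3 * s - 1) * (y2 - y1)); last by ring.
  by apply: ck'; apply/andP; split; lra.
- have := path_time_affine_ge (k := 1) (lambda := lambda) r0 r1 hp
    c5 c3 (lexx 1)
    (@broken_line3 _ _ _ _) (@broken_line3 _ _ _ _) ltr01
    (fun s _ => c_ell_le1 _ _ _ r1).
  rewrite invr1 mul1r (_ : 3 * (x3 - x2) * _ = x3 - x2); last by field.
  by rewrite (_ : 3 * (y3 - y2) * _ = y3 - y2); last by field.
Qed.

(** * The interface *)

Lemma gamC {R : realType} (u v : R) : gam u v = gam v u.
Proof. by rewrite /gam addrC. Qed.

Lemma le_gam {R : realType} (u v u' v' : R) :
  u <= u' -> v <= v' -> gam u v <= gam u' v'.
Proof.
move=> uu vv; rewrite /gam lerXn2r ?nnegrE ?addr_ge0 ?sqrtr_ge0 //.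
by rewrite lerD // ler_wsqrtr.
Qed.

(* In the cone [A ^+ 2 * u <= v] the derivative of [gam] along the diagonal is
   at least [2 + A + A^-1], its value on the ray [v = A ^+ 2 * u]. *)
Lemma gam_diagonal_increment {R : realType} (A u v d : R) :
  1 <= A -> 0 <= d -> d <= u -> d <= v -> A ^+ 2 * u <= v ->
  gam (u - d) (v - d) + (2 + A + A^-1) * d <= gam u v.
Proof.
move=> A1 d0 du dv Auv; have A0 : 0 < A by lra.
have u0 : 0 <= u by lra. have v0 : 0 <= v by lra.
have [u0'|upos] := leP u 0.
  have -> : d = 0 by lra.
  by rewrite !subr0 mulr0 addr0.
(* The tangent of parameter [t] touches [gam] at [(u, v)] and bounds it at the shifted point; its
   slope along the diagonal, [2 + t + t^-1], increases with [t >= 1]. *)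
pose t := Num.sqrt (v / u).
have t2 : t ^+ 2 = v / u by rewrite sqr_sqrtr // divr_ge0.
have At : A <= t.
  rewrite -(ler_pXn2r (n := 2)) ?nnegrE ?sqrtr_ge0 ?(ltW A0) // t2.
  by rewrite ler_pdivlMr.
have t0 : 0 < t by lra.
have vE : v = t ^+ 2 * u by rewrite t2 divfK // gt_eqF.
have := gam_tangent_eq t0 u0; rewrite -vE => ->.
have ud : 0 <= u - d by lra. have vd : 0 <= v - d by lra.
have := gam_le_tangent t0 ud vd.
suff : (A + A^-1) * d <= (t + t^-1) * d by nra.
rewrite ler_wpM2r // -subr_ge0.
have -> : t + t^-1 - (A + A^-1) = (t - A) * (A * t - 1) / (A * t).
  by field; rewrite !gt_eqF.
by rewrite divr_ge0 ?mulr_ge0 //; [lra|nra|lra|lra].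
Qed.

(** * The constants and the linear section *)

Lemma Acoef_gt1 {R : realType} (r : R) : 0 < r -> r < 1 -> 1 < Acoef r.
Proof.
move=> r0 r1; rewrite /Acoef ltr_pdivlMr // mul1r.
have q0 : 0 < Num.sqrt (1 - r) by rewrite sqrtr_gt0; lra.
by nra.
Qed.

(** With [q = sqrt (1 - r)] one has [r = (1 - q) * (1 + q)], hence [A = (1 + q) / (1 - q)]. The
    identity equates the rate of travel along the line with the diagonal slope of the tangents
    [t = A] and [t = A^-1]. *)
Lemma Acoef_rate {R : realType} (r : R) : 0 < r -> r < 1 ->
  4 / r = 2 + Acoef r + (Acoef r)^-1.
Proof.
move=> r0 r1; rewrite /Acoef; set q := Num.sqrt (1 - r).
have q0 : 0 < q by rewrite sqrtr_gt0; lra.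
have rE : r = (1 - q) * (1 + q).
  have : q ^+ 2 = 1 - r by rewrite sqr_sqrtr; lra.
  by move=> q2; nra.
have q1 : 1 - q != 0 by apply/eqP => q1; move: rE; rewrite q1 mul0r; lra.
have q2 : 1 + q != 0 by rewrite gt_eqF //; lra.
by rewrite rE; field; rewrite q1 q2.
Qed.

Lemma DcoefE {R : realType} (lambda r : R) : 0 < r -> r < 1 ->
  Dcoef lambda r = lambda * (Acoef r - (Acoef r)^-1).
Proof.
move=> r0 r1; rewrite /Dcoef /Acoef; set q := Num.sqrt (1 - r).
have q0 : 0 < q by rewrite sqrtr_gt0; lra.
have rE : r = (1 - q) * (1 + q).
  have : q ^+ 2 = 1 - r by rewrite sqr_sqrtr; lra.
  by move=> q2; nra.
have q1 : 1 - q != 0 by apply/eqP => q1; move: rE; rewrite q1 mul0r; lra.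
have q2 : 1 + q != 0 by rewrite gt_eqF //; lra.
by rewrite rE; field; rewrite q1 q2.
Qed.

(** With the tangent [t = A^-1] on the first term and [t = A] on the last, the coefficients of [a]
    and [b] cancel by [Acoef_rate]. *)
Lemma excursion_le_Isec {R : realType} (lambda r x y a b : R) :
  0 < r -> r < 1 -> 0 <= lambda -> lambda <= a -> a <= b -> b <= x ->
  b <= y + lambda ->
  gam a (a - lambda) + 4 / r * (b - a) + gam (x - b) (y - b + lambda) <=
  Isec lambda r x y.
Proof.
move=> r0 r1 l0 la ab bx byl; rewrite /Isec DcoefE // Acoef_rate //.
set A := Acoef r; have A0 : 0 < A by have := Acoef_gt1 r0 r1; rewrite -/A; lra.
have a0 : 0 <= a by lra. have al0 : 0 <= a - lambda by lra.
have xb0 : 0 <= x - b by lra. have yb0 : 0 <= y - b + lambda by lra.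
have Ai0 : 0 < A^-1 by rewrite invr_gt0.
have := gam_le_tangent Ai0 a0 al0; rewrite invrK.
by have := gam_le_tangent A0 xb0 yb0; lra.
Qed.

Lemma Isec_sub_gam {R : realType} (lambda r x y : R) :
  0 < r -> r < 1 -> 0 <= x -> 0 <= y ->
  Isec lambda r x y - gam x y =
  ((Acoef r * Num.sqrt x - Num.sqrt y) ^+ 2 - lambda * (Acoef r ^+ 2 - 1))
    / Acoef r.
Proof.
move=> r0 r1 x0 y0; rewrite /Isec DcoefE // gamE //.
have := Acoef_gt1 r0 r1; set A := Acoef r => A1.
rewrite -{1 2}(sqr_sqrtr x0) -{1 2}(sqr_sqrtr y0).
by field; rewrite gt_eqF //; lra.
Qed.

(** Abscissa of the point of the line where [x = A^2 * y], which is where the tangent [t = A^-1]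
    touches [gam]. *)
Definition tangency {R : realType} (lambda r : R) : R :=
  lambda * Acoef r ^+ 2 / (Acoef r ^+ 2 - 1).

Definition gap_root {R : realType} (lambda r : R) : R :=
  Num.sqrt (lambda * (Acoef r ^+ 2 - 1)).

(** One root in [y] of the conic; the other is [(A * sqrt x + gap_root)^2]. *)
Definition interface_fun {R : realType} (lambda r x : R) : R :=
  (Acoef r * Num.sqrt x - gap_root lambda r) ^+ 2.

Section interface_geometry.
Context {R : realType} (lambda r : R).
Hypotheses (l0 : 0 <= lambda) (r0 : 0 < r) (r1 : r < 1).
Let A := Acoef r.
Let x0 := tangency lambda r.
Let kap := gap_root lambda r.

Let A1 : 1 < A. Proof. exact: Acoef_gt1. Qed.
Let A2 : 0 < A ^+ 2 - 1. Proof. by have := A1; nra. Qed.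

Let kap_ge0 : 0 <= kap. Proof. exact: sqrtr_ge0. Qed.
Let kap2 : kap ^+ 2 = lambda * (A ^+ 2 - 1).
Proof. by rewrite /kap /gap_root sqr_sqrtr // mulr_ge0 // ltW. Qed.

Lemma tangencyE : (A ^+ 2 - 1) * x0 = lambda * A ^+ 2.
Proof. by rewrite /x0 /tangency -/A mulrC divfK // gt_eqF. Qed.

Lemma tangency_ge : lambda <= x0.
Proof. by rewrite -(ler_pM2l A2) tangencyE; have := l0; lra. Qed.

Let x0_ge0 : 0 <= x0. Proof. exact: le_trans tangency_ge. Qed.

(** Follows from [tangencyE] under the square root; it removes the radicals from the cross term of
    [interface_fun] at the tangency point. *)
Lemma sqrt_tangency : kap * Num.sqrt x0 = lambda * A.
Proof.
have A0 : 0 <= A by have := A1; lra.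
rewrite /kap /gap_root -sqrtrM; last by rewrite mulr_ge0 // ltW.
rewrite -mulrA tangencyE mulrA -expr2 -exprMn sqrtr_sqr.
by rewrite ger0_norm // mulr_ge0.
Qed.

(** Makes the base of the square in [interface_fun] nonnegative, so that comparisons with [y] pass
    to square roots. *)
Lemma gap_root_le x : x0 <= x -> kap <= A * Num.sqrt x.
Proof.
move=> x0x; have xge0 : 0 <= x by exact: le_trans x0x.
have A0 : 0 <= A by have := A1; lra.
have As0 : 0 <= A * Num.sqrt x by rewrite mulr_ge0 ?sqrtr_ge0.
rewrite -(ler_pXn2r (n := 2)) ?nnegrE //.
rewrite kap2 [(A * _) ^+ 2]exprMn sqr_sqrtr //.
have : lambda <= x by exact: le_trans tangency_ge x0x.
by have := A2; have := l0; nra.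
Qed.

Lemma interface_tangency : interface_fun lambda r x0 = x0 - lambda.
Proof.
rewrite /interface_fun -/A -/kap.
rewrite (_ : (_ - _) ^+ 2 = A ^+ 2 * Num.sqrt x0 ^+ 2
  - 2 * A * (kap * Num.sqrt x0) + kap ^+ 2); last by ring.
rewrite sqr_sqrtr // kap2 sqrt_tangency.
by have := tangencyE; lra.
Qed.

Lemma interface_ge x : 0 <= x -> x - lambda <= interface_fun lambda r x.
Proof.
move=> x_ge0; rewrite /interface_fun -/A -/kap -subr_ge0.
pose e := Num.sqrt (A ^+ 2 - 1); pose m := Num.sqrt lambda.
have e2 : e ^+ 2 = A ^+ 2 - 1 by rewrite sqr_sqrtr // ltW.
have m2 : m ^+ 2 = lambda by rewrite sqr_sqrtr.
have kE : kap = m * e by rewrite /kap /gap_root sqrtrM.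
(* The difference is a perfect square, whence the tangency; the identity holds modulo
   [e^2 = A^2 - 1]. *)
have -> : (A * Num.sqrt x - kap) ^+ 2 - (x - lambda) =
    (e * Num.sqrt x - A * m) ^+ 2.
  rewrite -[in (x - lambda)](sqr_sqrtr x_ge0) -m2 kE.
  rewrite [RHS](_ : _ = (A * Num.sqrt x - m * e) ^+ 2 -
    (Num.sqrt x ^+ 2 - m ^+ 2) +
    (e ^+ 2 - (A ^+ 2 - 1)) * (Num.sqrt x ^+ 2 - m ^+ 2)); last by ring.
  by rewrite e2 subrr mul0r addr0.
exact: sqr_ge0.
Qed.

Lemma conic_interface x : 0 <= x ->
  conic lambda r x (interface_fun lambda r x) = 0.
Proof.
move=> x_ge0; rewrite /conic DcoefE // -/A /interface_fun -/A -/kap.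
have -> : lambda * (A - A^-1) = kap ^+ 2 / A.
  by rewrite kap2; field; rewrite gt_eqF //; have := A1; lra.
rewrite -{1 3}(sqr_sqrtr x_ge0).
by field; rewrite gt_eqF //; have := A1; lra.
Qed.

Lemma interface_interface_fun : interface lambda r x0 (interface_fun lambda r).
Proof.
split.
- split; first exact: tangency_ge.
  by rewrite -interface_tangency conic_interface.
- exact: interface_tangency.
- apply: continuous_subspaceT => x; rewrite /interface_fun.
  apply: (@continuous_comp _ _ _ (fun x => A * Num.sqrt x - kap)
    (fun z => z ^+ 2)).
    apply: cvgB; last exact: cvg_cst.
    by apply: cvgMr; exact: sqrt_continuous.
  exact: exprn_continuous.
- move=> x x0x; have x_ge0 : 0 <= x by exact: le_trans x0x.
  by split; [exact: interface_ge|exact: conic_interface].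
Qed.

End interface_geometry.

(** * The shape function *)

(** The straight segment, as a broken line with two trivial pieces. *)
Lemma gam_le_Gam {R : realType} (lambda r x y : R) :
  0 < r -> r <= 1 -> 0 <= x -> 0 <= y ->
  ((gam x y)%:E <= Gam (c_ell lambda r) x y)%E.
Proof.
move=> r0 r1 x_ge0 y_ge0.
have := @Gam_ge_broken_line R lambda r 1 0 0 x 0 0 y r0 r1.
rewrite !subr0 !gam00 mulr0 !add0r.
by apply => // h _; exact: c_ell_le1.
Qed.

(* A path hugging the line between abscissas [a] and [b] loses to the path
   that crosses it at [b] when [b] lies before the tangency point, and to the
   path that leaves it at [a] when the target lies above [y = A ^+ 2 * x]. *)
Lemma excursion_le_gam {R : realType} (lambda r x y a b : R) :
  0 < r -> r < 1 -> 0 <= lambda -> 0 <= x -> 0 <= y ->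
  x - lambda <= y ->
  (tangency lambda r <= x -> interface_fun lambda r x <= y) ->
  lambda <= a -> a <= b -> b <= x -> b <= y + lambda ->
  gam a (a - lambda) + 4 / r * (b - a) + gam (x - b) (y - b + lambda) <=
  gam x y.
Proof.
move=> r0 r1 l0 x_ge0 y_ge0 xy Ly la ab bx byl.
have A1 := Acoef_gt1 r0 r1.
have := Acoef_rate r0 r1; have := Isec_sub_gam lambda r0 r1 x_ge0 y_ge0.
have := gap_root_le l0 r0 r1; have := tangencyE lambda r0 r1.
move: Ly; rewrite /interface_fun /gap_root.
set A := Acoef r in A1 *; set x0 := tangency lambda r => Ly tE kle IE rE.
have AA : 0 < A ^+ 2 - 1 by nra.
have [xx0|x0x] := ltP x x0.
  (* This is the cone condition of [gam_diagonal_increment] for the swapped pair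
     [(b - lambda, b)]. *)
  have Ab : A ^+ 2 * (b - lambda) <= b.
    by have := ler_wpM2l (ltW AA) (le_trans bx (ltW xx0)); rewrite tE; lra.
  have := @gam_diagonal_increment R A (b - lambda) b (b - a).
  rewrite (_ : b - lambda - (b - a) = a - lambda); last by ring.
  rewrite (_ : b - (b - a) = a); last by ring.
  rewrite -rE gamC [gam (b - lambda) b]gamC => H.
  have {}H : gam a (a - lambda) + 4 / r * (b - a) <= gam b (b - lambda).
    by apply: H; lra.
  apply: le_trans (lerD H (lexx _)) _.
  apply: le_trans (gam_superadditive _ _ _ _) _; [lra|lra|lra|lra|].
  by apply: le_gam; lra.
have [yA|Ay] := leP y (A ^+ 2 * x); last first.
  have H : gam (x - b) (y - b + lambda) + 4 / r * (b - a) <=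
      gam (x - a) (y - a + lambda).
    rewrite rE.
    have -> : x - b = x - a - (b - a) by ring.
    have -> : y - b + lambda = y - a + lambda - (b - a) by ring.
    by apply: gam_diagonal_increment; [lra|lra|lra|lra|nra].
  rewrite -addrA [_ + gam _ _]addrC; apply: le_trans (lerD (lexx _) H) _.
  apply: le_trans (gam_superadditive _ _ _ _) _; [lra|lra|lra|lra|].
  by apply: le_gam; lra.
(* In the remaining region [0 <= A * sqrt x - sqrt y <= gap_root], so the linear section is at most
   [gam]. *)
apply: le_trans (excursion_le_Isec r0 r1 l0 la ab bx byl) _.
rewrite -subr_le0 IE.
rewrite mulr_le0_ge0 ?invr_ge0 //; last by lra.
have k2 : Num.sqrt (lambda * (A ^+ 2 - 1)) ^+ 2 = lambda * (A ^+ 2 - 1).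
  by rewrite sqr_sqrtr // mulr_ge0 // ltW.
have A0 : 0 <= A by lra.
have sy : Num.sqrt y <= A * Num.sqrt x.
  rewrite -[A in leRHS](ger0_norm A0) -sqrtr_sqr -sqrtrM ?sqr_ge0 //.
  exact: ler_wsqrtr.
have ks : A * Num.sqrt x - Num.sqrt (lambda * (A ^+ 2 - 1)) <= Num.sqrt y.
  have h : 0 <= A * Num.sqrt x - Num.sqrt (lambda * (A ^+ 2 - 1)).
    by rewrite subr_ge0 kle.
  by rewrite -[leLHS](ger0_norm h) -sqrtr_sqr ler_wsqrtr // Ly.
rewrite -k2 subr_le0 lerXn2r ?nnegrE ?sqrtr_ge0 ?subr_ge0 //.
by rewrite lerBlDl -lerBlDr.
Qed.

Lemma Gam_gam {R : realType} (lambda r x y : R) :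
  0 <= lambda -> 0 < r -> r < 1 -> 0 <= x -> 0 <= y -> x - lambda <= y ->
  (tangency lambda r <= x -> interface_fun lambda r x <= y) ->
  Gam (c_ell lambda r) x y = (gam x y)%:E.
Proof.
move=> l0 r0 r1 x_ge0 y_ge0 xy Ly; apply/le_anti/andP; split; last first.
  by apply: gam_le_Gam => //; exact: ltW.
apply: ge_ereal_sup => _ [p hp <-].
have [//|[a [b [la ab bx byl]]]] := path_time_above_line l0 r0 r1 xy hp.
move=> /le_trans; apply; rewrite lee_fin; exact: excursion_le_gam.
Qed.

(** The optimal path goes straight to the tangency point, follows the line up to abscissa [b], and
    leaves it with slope [A^2]. *)
Lemma Gam_Isec {R : realType} (lambda r x y : R) :
  0 <= lambda -> 0 < r -> r < 1 -> 0 <= x -> 0 <= y ->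
  tangency lambda r <= x -> x - lambda <= y -> y <= interface_fun lambda r x ->
  Gam (c_ell lambda r) x y = (Isec lambda r x y)%:E.
Proof.
move=> l0 r0 r1 x_ge0 y_ge0 x0x xy yL.
have A1 := Acoef_gt1 r0 r1; have A0 : 0 < Acoef r by lra.
have AA : 0 < Acoef r ^+ 2 - 1 by nra.
have kle := gap_root_le l0 r0 r1 x0x.
have k2 : gap_root lambda r ^+ 2 = lambda * (Acoef r ^+ 2 - 1).
  by rewrite /gap_root sqr_sqrtr // mulr_ge0 // ltW.
have k0 : 0 <= gap_root lambda r by exact: sqrtr_ge0.
have tE := tangencyE lambda r0 r1; have ltan := tangency_ge l0 r0 r1.
apply/le_anti/andP; split.
  apply: ge_ereal_sup => _ [p hp <-].
  have [|[a [b [la ab bx byl]]]] := path_time_above_line l0 r0 r1 xy hp;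
    move=> /le_trans; apply; rewrite lee_fin; last exact: excursion_le_Isec.
  rewrite -subr_ge0 Isec_sub_gam // divr_ge0 ?(ltW A0) //.
  have sy : Num.sqrt y <= Acoef r * Num.sqrt x - gap_root lambda r.
    have As0 : 0 <= Acoef r * Num.sqrt x - gap_root lambda r by lra.
    by rewrite -[leRHS](ger0_norm As0) -sqrtr_sqr ler_wsqrtr.
  by rewrite -k2 subr_ge0 lerXn2r ?nnegrE //; lra.
(* The line of slope [A^2] through [(x, y)] meets [y = x - lambda] at this abscissa. *)
pose b := (Acoef r ^+ 2 * x - y - lambda) / (Acoef r ^+ 2 - 1).
have bE : (Acoef r ^+ 2 - 1) * b = Acoef r ^+ 2 * x - y - lambda.
  by rewrite /b mulrC divfK // gt_eqF.
have bx : b <= x by rewrite -(ler_pM2l AA) bE; lra.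
(* To the right of the tangency point the interface stays below the line of slope [A^2] through that
   point. *)
have x0b : tangency lambda r <= b.
  rewrite -(ler_pM2l AA) bE tE.
  have := sqrt_tangency l0 r0 r1.
  have := ler_wsqrtr x0x; move/(ler_wpM2l k0) => + E; rewrite E.
  move: yL; rewrite /interface_fun.
  rewrite (_ : (_ - _) ^+ 2 = Acoef r ^+ 2 * Num.sqrt x ^+ 2
    - 2 * Acoef r * (gap_root lambda r * Num.sqrt x) + gap_root lambda r ^+ 2);
    last by ring.
  rewrite sqr_sqrtr // k2 => yL /(ler_wpM2l (ltW A0)); lra.
set x0 := tangency lambda r in x0x tE ltan x0b *.
have yb : y - (b - lambda) = Acoef r ^+ 2 * (x - b) by lra.
have := @Gam_ge_broken_line R lambda r r x0 b x (x0 - lambda) (b - lambda) y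
  r0 (ltW r1).
(* Both outer segments lie on rays where their tangents are attained, so their times are linear. *)
have x0E : x0 = Acoef r ^+ 2 * (x0 - lambda) by lra.
have -> : gam x0 (x0 - lambda) =
    (1 + Acoef r) * (x0 - lambda) + (1 + (Acoef r)^-1) * x0.
  rewrite gamC {2 4}x0E gam_tangent_eq //; lra.
have -> : gam (x - b) (y - (b - lambda)) =
    (1 + Acoef r) * (x - b) + (1 + (Acoef r)^-1) * (y - (b - lambda)).
  by rewrite yb gam_tangent_eq // subr_ge0.
have -> : r^-1 * gam (b - x0) (b - lambda - (x0 - lambda)) = 4 / r * (b - x0).
  have -> : b - lambda - (x0 - lambda) = b - x0 by ring.
  rewrite gamE ?subr_ge0 // -expr2 sqr_sqrtr ?subr_ge0 //.
  by field; rewrite gt_eqF.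
rewrite Acoef_rate // /Isec DcoefE //.
have by_ : b - lambda <= y.
  by rewrite -subr_ge0 yb mulr_ge0 ?sqr_ge0 ?subr_ge0.
(* On the line itself the speed is [r], the test in [c_ell] being strict. *)
have line h : 0 <= h <= 1 ->
    c_ell lambda r (x0 + h * (b - x0))
      (x0 - lambda + h * (b - lambda - (x0 - lambda))) <= r.
  by move=> _; rewrite /c_ell ifF //; apply/negbTE; rewrite -leNgt; lra.
move=> /(_ _ _ _ _ _ _ r0 line) H; apply: le_trans (H _ x0b bx _ _ by_);
  rewrite ?lee_fin; lra.
Qed.

(** * Targets below the line *)

Lemma crossing_continuous {R : realType} (lambda r x y : R) :
  continuous (crossing lambda r x y).
Proof.
have cgam (u v : R -> R) : continuous u -> continuous v ->
    continuous (fun a => gam (u a) (v a)).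
  move=> cu cv a; rewrite /gam.
  apply: (@continuous_comp _ _ _ (fun a => Num.sqrt (u a) + Num.sqrt (v a))
    (fun z => z ^+ 2)); last exact: exprn_continuous.
  apply: cvgD.
    apply: (@continuous_comp _ _ _ u Num.sqrt); first exact: cu.
    exact: sqrt_continuous.
  apply: (@continuous_comp _ _ _ v Num.sqrt); first exact: cv.
  exact: sqrt_continuous.
have cid : continuous (fun a : R => a) by move=> a; exact: cvg_id.
have ccst (k : R) : continuous (fun a : R => k) by move=> a; exact: cvg_cst.
move=> a; apply: cvgD; first by apply: (cgam id (fun a => a - lambda)) => // b;
  exact: (cvgB (cid _) (ccst _ _)).
apply: cvgMr; apply: (cgam (fun a => x - a) (fun a => y - a + lambda)) => b.
  exact: (cvgB (ccst _ _) (cid _)).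
by apply: cvgD; [exact: (cvgB (ccst _ _) (cid _))|exact: ccst].
Qed.

(* Near [a = lambda] the first term of [crossing] grows like
   [2 * sqrt (lambda * (a - lambda))] while the second one decreases at most
   linearly. *)
Lemma crossing_max_gt {R : realType} (lambda r x y a : R) :
  0 < lambda -> 0 < r -> 0 < y -> y < x - lambda -> lambda <= a ->
  (forall b, lambda <= b <= y + lambda ->
    crossing lambda r x y b <= crossing lambda r x y a) ->
  lambda < a.
Proof.
move=> l0 r0 y0 yx; rewrite le_eqVlt => /orP[/eqP <-|//] amax; exfalso.
pose X := x - lambda; pose C := r^-1 * gam X y / y.
have Xy : gam X y > 0.
  rewrite gamE /X; [|lra|lra].
  have := sqrtr_ge0 (x - lambda); have := sqrtr_ge0 y; nra.
have C0 : 0 < C by rewrite divr_gt0 // mulr_gt0 // invr_gt0.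
(* The competitor is [lambda + h^2], so that the square root yields [h]. The two bounds give
   [h^2 <= y], for admissibility, and [C * h <= sqrt lambda], so that the loss [C * h^2] is below
   the gain of at least [2 * sqrt lambda * h]. *)
pose h := Num.min (Num.sqrt y) (Num.sqrt lambda / C).
have h0 : 0 < h by rewrite lt_min sqrtr_gt0 y0 divr_gt0 // sqrtr_gt0.
have hy : h ^+ 2 <= y.
  rewrite -[leRHS](sqr_sqrtr (ltW y0)) lerXn2r ?nnegrE ?sqrtr_ge0 ?(ltW h0) //.
  by rewrite ge_min lexx.
have hC : C * h <= Num.sqrt lambda.
  by rewrite mulrC -ler_pdivlMr // ge_min lexx orbT.
have := amax (lambda + h ^+ 2); rewrite /crossing.
have -> : lambda + h ^+ 2 - lambda = h ^+ 2 by ring.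
rewrite subrr subrK => H.
have h2 : 0 < h ^+ 2 by rewrite exprn_gt0.
have {}H := H _; move: H.
rewrite (gamE (ltW l0) (lexx 0)) sqrtr0 mulr0 mulr0 !addr0.
rewrite (@gamE _ (lambda + h ^+ 2)) ?sqr_ge0 //; last by lra.
rewrite sqrtr_sqr (gtr0_norm h0) -/X.
have hs : Num.sqrt lambda * h <= Num.sqrt (lambda + h ^+ 2) * h.
  by rewrite ler_wpM2r ?(ltW h0) // ler_wsqrtr; lra.
(* As [y < X], the scaled vector [k * (X, y)] is dominated by [(X - h^2, y - h^2)], with equal
   second coordinates; homogeneity makes the loss linear in [h^2]. *)
pose k := 1 - h ^+ 2 / y.
have k0 : 0 <= k by rewrite subr_ge0 ler_pdivrMr // mul1r.
have low : k * gam X y <=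
    gam (x - (lambda + h ^+ 2)) (y - (lambda + h ^+ 2) + lambda).
  rewrite -gamZ //; apply: le_gam.
    have : h ^+ 2 <= h ^+ 2 / y * X.
      by rewrite mulrAC ler_pdivlMr // ler_wpM2l ?(ltW h2) // /X; lra.
    by rewrite /k /X; lra.
  by rewrite /k mulrBl mul1r divfK ?gt_eqF //; lra.
have ri : 0 <= r^-1 by rewrite invr_ge0 ltW.
have := ler_wpM2l ri low.
have -> : r^-1 * (k * gam X y) = r^-1 * gam X y - h * (C * h).
  by rewrite /k /C; field; rewrite !gt_eqF.
have := ler_wpM2l (ltW h0) hC.
have sl : 0 < Num.sqrt lambda * h by rewrite mulr_gt0 ?sqrtr_gt0.
have inr : lambda <= lambda + h ^+ 2 <= y + lambda by apply/andP; split; lra.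
by move=> e1 e2 /(_ inr); lra.
Qed.

Lemma exists_optimal_point {R : realType} (lambda r x y : R) :
  0 <= lambda -> 0 < r -> 0 <= y -> y < x - lambda ->
  exists a, optimal_point lambda r x y a.
Proof.
move=> l0 r0 y0 yx.
have ly : lambda <= y + lambda by lra.
have [a] := EVT_max ly
  (continuous_subspaceT (@crossing_continuous R lambda r x y)).
rewrite in_itv /= => la amax.
have {}amax b : lambda <= b <= y + lambda ->
    crossing lambda r x y b <= crossing lambda r x y a.
  by move=> hb; apply: amax; rewrite in_itv.
exists a; split => // lpos ypos.
by case/andP: la => la _; exact: crossing_max_gt amax.
Qed.

(** The upper bound holds at some crossing point and hence at the optimal one; the broken line
    through that point, with a trivial third piece, attains it. *)
Lemma Gam_crossing {R : realType} (lambda r x y a : R) :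
  0 <= lambda -> 0 < r -> r < 1 -> 0 <= x -> 0 <= y -> y < x - lambda ->
  optimal_point lambda r x y a ->
  Gam (c_ell lambda r) x y = (crossing lambda r x y a)%:E.
Proof.
move=> l0 r0 r1 x_ge0 y_ge0 yx [/andP[la ay] _ amax].
apply/le_anti/andP; split.
  apply: ge_ereal_sup => _ [p hp <-].
  have [b hb /le_trans] := path_time_below_line l0 r0 r1 yx hp.
  by apply; rewrite lee_fin amax.
have := @Gam_ge_broken_line R lambda r r a x x (a - lambda) y y r0 (ltW r1).
rewrite !subrr gam00 addr0 /crossing.
have -> : y - (a - lambda) = y - a + lambda by ring.
apply => //; try lra.
(* The second segment starts on the line and ends below it, so it never rises above it. *)
move=> h /andP[h0 _]; rewrite /c_ell ifF //; apply/negbTE; rewrite -leNgt.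
have : h * (y + lambda - x) <= 0 by rewrite mulr_ge0_le0 //; lra.
by lra.
Qed.

Unset Implicit Arguments.
Set Strict Implicit.

Theorem theorem2p7 (R : realType) (lambda r : R)
    (hlambda : 0 <= lambda) (hr0 : 0 < r) (hr1 : r < 1) :
  exists (astar : R -> R -> R) (x0 : R) (L : R -> R),
    interface lambda r x0 L /\
    forall x y : R, 0 <= x -> 0 <= y ->
      [/\ x - lambda <= y -> (x0 <= x -> L x <= y) ->
            Gam (c_ell lambda r) x y = (gam x y)%:E,
          x0 <= x -> x - lambda <= y -> y <= L x ->
            Gam (c_ell lambda r) x y = (Isec lambda r x y)%:E &
          y < x - lambda ->
            optimal_point lambda r x y (astar x y) /\
            Gam (c_ell lambda r) x y =
              (gam (astar x y) (astar x y - lambda)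
               + r^-1 * gam (x - astar x y) (y - astar x y + lambda))%:E].
Proof.
(* An optimal point is chosen for each target; the default [0] occurs only where there is none. *)
exists (fun x y => xget 0 (optimal_point lambda r x y)).
exists (tangency lambda r), (interface_fun lambda r).
split; first exact: interface_interface_fun.
move=> x y x_ge0 y_ge0; split.
- exact: Gam_gam.
- exact: Gam_Isec.
move=> yx.
have [a ha] := exists_optimal_point hlambda hr0 y_ge0 yx.
have opt := xgetPex 0 (ex_intro _ a ha).
by split => //; exact: Gam_crossing.
Qed.
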